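(* For all $j\in\mathbb N$ and all $0<x\le1$, $$\frac{|\phi_j(x)|}{x}\le C_0|\lambda_j|^3,\qquad\text{where } C_0=\frac13+\frac{1}{72\sqrt3\,e}.$$
   Context: Let $K:[0,1]\times[0,1]\to\mathbb R$ be defined by $K(x,y)=\frac12-\{(xy)^{-1}\}$ if $0<x,y\le 1$, and $K(x,y)=0$ if $0\le x,y\le1$ and $xy=0$, where $\{\alpha\}=\alpha-\lfloor\alpha\rfloor$. Let $L^2([0,1])$ denote the space of real-valued Lebesgue measurable square-integrable functions on $[0,1]$, with $\langle f,g\rangle=\int_0^1 f(x)g(x)\,dx$ and $\|f\|=\langle f,f\rangle^{1/2}$. A function $\phi$ is an eigenfunction of $K$ (with eigenvalue $\lambda\in\mathbb R$) if $\phi\in L^2([0,1])$, $\|\phi\|>0$, and $\phi(x)=\lambda\int_0^1 K(x,y)\phi(y)\,dy$ for every $x\in[0,1]$. Let $\phi_1,\phi_2,\ldots$ be a maximal orthonormal system in $L^2([0,1])$ of eigenfunctions of $K$, $\phi_j$ having the nonzero real eigenvalue $\lambda_j$, numbered so that $0<|\lambda_1|\le|\lambda_2|\le\cdots$ and $\lambda_j\ge\lambda_{j+1}$ whenever $|\lambda_j|=|\lambda_{j+1}|$. *)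

(* Defs.v *)
From mathcomp Require Import all_boot all_order all_algebra.
From mathcomp Require Import all_classical all_reals all_analysis.
Set Implicit Arguments. Unset Strict Implicit. Unset Printing Implicit Defensive.
Import Order.TTheory GRing.Theory Num.Theory.
Import numFieldNormedType.Exports.
Local Open Scope classical_set_scope.
Local Open Scope ring_scope.

Section Defs.
Variable R : realType.

Definition frac (a : R) : R := a - (Num.floor a)%:~R.

(* the kernel K on [0,1]^2 (values outside [0,1]^2 are irrelevant) *)
Definition Kker (x y : R) : R :=
  if (0 < x) && (0 < y) then 2^-1 - frac ((x * y)^-1) else 0.

Definition unitI : set R := `[0%R, 1%R].

Definition inL2 (f : R -> R) : Prop :=
  measurable_fun unitI f /\
  (@lebesgue_measure R).-integrable unitI (fun x => ((f x) ^+ 2)%:E).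

Definition ip (f g : R -> R) : R :=
  Rintegral (@lebesgue_measure R) unitI (fun x => f x * g x).

Definition eigenfun (phi : R -> R) (lam : R) : Prop :=
  inL2 phi /\ 0 < ip phi phi /\
  forall x, x \in unitI ->
    phi x = lam * Rintegral (@lebesgue_measure R) unitI (fun y => Kker x y * phi y).

(* phi_0, phi_1, ... (index shifted by one w.r.t. the paper) is a maximal
   orthonormal system of eigenfunctions with nonzero eigenvalues lam_j,
   ordered as in the paper. *)
Definition max_orthonormal_eigensystem (phi : nat -> R -> R) (lam : nat -> R) : Prop :=
  (forall j, eigenfun (phi j) (lam j) /\ lam j != 0) /\
  (forall i j, ip (phi i) (phi j) = if i == j then 1 else 0) /\
  (forall psi mu, eigenfun psi mu -> mu != 0 ->
     ~ (forall j, ip psi (phi j) = 0)) /\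
  (forall j, `|lam j| <= `|lam j.+1|) /\
  (forall j, `|lam j| = `|lam j.+1| -> lam j.+1 <= lam j).

Definition C0 : R := 3^-1 + (72 * Num.sqrt 3 * expR 1)^-1.

End Defs.

(* Main.v *)
(** Write [k (u) = 1/2 - {1/u}], so that [K (x, y) = k (x y)], and let
    [K2 (x, y) = int_0^1 K (x, z) K (y, z) dz]; applying the eigenvalue equation
    twice gives [phi (x) = lam^2 int_0^1 K2 (x, y) phi (y) dy].

    The rapid oscillation of [K (x, .)] yields the factor [x].  With
    [A (v) = {v} (1 - {v}) / 2], which lies in [[0, 1/8]],
    [K (x, z) = 2 x z A (1/(x z)) - d/dz (x z^2 A (1/(x z)))].  Integrating by
    parts on each interval where [K (y, .)] has no jump, that is
    [1/((n+1) y) < z <= 1/(n y)], and summing over [n] gives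
    [|K2 (x, y)| <= 3 x / 16 + x / (8 y)].

    It remains to bound [int_0^1 |phi (y)| / y dy] by a multiple of [|lam|].
    From [|K2 (x, y)| <= min (1/4, 5 x / (16 y))] and the normalisation of [phi]
    one gets [|phi (y)| <= (5/12) lam^2 sqrt y]; this is used for
    [y <= lam^-2], and the normalisation of [phi] alone for [y >= lam^-2].
    Since [|lam| >= 2], the total is at most [|lam|^3 x / 3], and [1/3 < C0]. *)
Require Import Defs.
From mathcomp Require Import all_boot all_order all_algebra.
From mathcomp Require Import all_classical all_reals all_analysis.
From mathcomp Require Import measurable_realfun ring lra.
Set Implicit Arguments. Unset Strict Implicit. Unset Printing Implicit Defensive.
Import Order.TTheory GRing.Theory Num.Theory.
Import numFieldNormedType.Exports.
Local Open Scope classical_set_scope.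
Local Open Scope ring_scope.

(** * Integrals of explicit functions over half-open intervals *)

Section Integration.
Variable R : realType.
Local Notation mu := (@lebesgue_measure R).
Implicit Types (f F : R -> R) (a b c : R).

(** Intervals are open on the left and closed on the right because the formula for [Kker x] between
    two consecutive jumps holds at the right one and fails at the left one. *)
Lemma Rintegral_FTC_oc f F a b : 0 < a -> a <= b ->
  (forall z : R, 0 < z -> is_derive z (1 : R) F (f z)) ->
  (forall z : R, 0 < z -> derivable f z 1) ->
  mu.-integrable `]a, b] (EFin \o f) /\
  Rintegral mu `]a, b] f = F b - F a.
Proof.
move=> a0; rewrite le_eqVlt => /predU1P[<-|ab] dF df.
  by rewrite set_itvoc0 subrr Rintegral_set0; split=> //; exact: integrable_set0.
have cf : {within `[a, b], continuous f}.
  apply: derivable_within_continuous => z; rewrite in_itv/= => /andP[az _].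
  exact/df/(lt_le_trans a0).
have fi : mu.-integrable `[a, b] (EFin \o f).
  by apply: continuous_compact_integrable => //; exact: segment_compact.
have fi' : mu.-integrable `]a, b] (EFin \o f).
  by apply: integrableS fi => //; exact: subset_itv_oc_cc.
have cF z : 0 < z -> {for z, continuous F}.
  move=> z0; apply: differentiable_continuous; apply/derivable1_diffP.
  by have := dF _ z0 => -[].
split=> //; rewrite Rintegral_itv_obnd_cbnd// /Rintegral.
rewrite (@continuous_FTC2 _ f F)//.
- split.
  + move=> z; rewrite in_itv/= => /andP[az _].
    by have := dF _ (lt_trans a0 az) => -[].
  + exact/cvg_at_right_filter/cF.
  + exact/cvg_at_left_filter/cF/(lt_trans a0).
- move=> z; rewrite in_itv/= => /andP[az _]; rewrite derive1E.
  by have := dF _ (lt_trans a0 az) => -[].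
Qed.

Lemma is_derive_inv_exp (z : R) n : 0 < z ->
  is_derive z (1 : R) (fun z : R => z ^- n) (- n%:R * z ^- n.+1).
Proof.
move=> z0; have z0' : z ^+ n != 0 by rewrite expf_neq0// gt_eqF.
have dn : is_derive z (1 : R) (fun z : R => z ^+ n) (n%:R * z ^+ n.-1).
  have := @is_deriveX _ _ id n z 1 1 (is_derive_id _ _).
  have -> : (id ^+ n : R -> R) = (fun z : R => z ^+ n) by apply/funext => y; rewrite fctE.
  by rewrite /GRing.scale/= mulr1.
have D := @is_deriveV R (fun z : R => z ^+ n) z _ 1 z0' dn.
suff <- : - (z ^+ n) ^- 2 *: (n%:R * z ^+ n.-1) = - n%:R * z ^- n.+1 by exact: D.
rewrite /GRing.scale/=; case: n {z0' dn D} => [|n]; first by rewrite !mul0r mulr0 oppr0 mul0r.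
rewrite !exprS; field; rewrite ?expf_neq0 ?gt_eqF//.
Qed.

(** There is no [1/z] term, hence no logarithm: the functions compared below with
    [Kker x z * (al + be / z)] all have this shape. *)
Lemma Rintegral_laurent c1 c2 c3 a b : 0 < a -> a <= b ->
  let f := fun z : R => c1 * z + c2 + c3 * z ^- 2 in
  let F := fun z : R => c1 * z ^+ 2 / 2 + c2 * z - c3 * z^-1 in
  mu.-integrable `]a, b] (EFin \o f) /\
  Rintegral mu `]a, b] f = F b - F a.
Proof.
move=> a0 ab f F; apply: (@Rintegral_FTC_oc f F a b a0 ab) => z z0.
- have d1 := @is_derive_inv_exp z 1 z0.
  have d2 := is_derive_id z (1 : R).
  have D := is_deriveB (is_deriveD (is_deriveZ (c1 / 2) (is_deriveX 2 d2))
    (is_deriveZ c2 d2)) (is_deriveZ c3 d1).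
  have -> : F = (c1 / 2) *: (id ^+ 2) + c2 *: id - c3 *: (fun z : R => z ^- 1) :> (R -> R).
    by apply/funext => y; rewrite /F !fctE /GRing.scale/= expr1; ring.
  refine (is_derive_eq D _).
  rewrite /f /GRing.scale/= expr1.
  by field; rewrite gt_eqF.
- have d1 := @is_derive_inv_exp z 2 z0.
  have d2 := is_derive_id z (1 : R).
  have D := is_deriveD (is_deriveD (is_deriveZ c1 d2)
    (is_derive_cst c2 z (1 : R))) (is_deriveZ c3 d1).
  by case: D.
Qed.

Lemma Rintegral_oc_split f a b c : a <= b -> b <= c ->
  mu.-integrable `]a, c] (EFin \o f) ->
  Rintegral mu `]a, c] f = Rintegral mu `]a, b] f + Rintegral mu `]b, c] f.
Proof.
move=> ab bc fi; have := @Rintegral_itvB _ f (BRight a) (BRight c) b fi.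
by rewrite !bnd_simp => /(_ ab bc) <-; rewrite addrCA subrr addr0.
Qed.

Lemma integrable_oc_sub f a b c d : c <= a -> b <= d ->
  mu.-integrable `]c, d] (EFin \o f) -> mu.-integrable `]a, b] (EFin \o f).
Proof.
move=> ca bd; apply: integrableS => //.
by apply: subset_itv; rewrite bnd_simp.
Qed.

Lemma integrable_oc_cst c a b : mu.-integrable `]a, b] (EFin \o cst c).
Proof.
apply: measurable_bounded_integrable => //.
- rewrite /= lebesgue_measure_itv/=.
  by case: ifP => _; rewrite ?ltry// -EFinB ltry.
- exists `|c|; split=> [|e e2 z _ /=]; first exact: num_real.
  exact: ltW.
Qed.

Lemma Rintegral_oc_cst c a b : a <= b -> Rintegral mu `]a, b] (cst c) = c * (b - a).
Proof.
move=> ab; rewrite Rintegral_cst//= lebesgue_measure_itv/= lte_fin.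
by case: ltgtP ab => // <-; rewrite subrr.
Qed.

Lemma normr_Rintegral_oc f a b : mu.-integrable `]a, b] (EFin \o f) ->
  `|Rintegral mu `]a, b] f| <= Rintegral mu `]a, b] (fun z => `|f z|).
Proof. exact: le_normr_Rintegral. Qed.

Lemma Rintegral_oc_bound f c a b : a <= b ->
  mu.-integrable `]a, b] (EFin \o f) ->
  (forall z, a < z -> z <= b -> `|f z| <= c) ->
  `|Rintegral mu `]a, b] f| <= c * (b - a).
Proof.
move=> ab fi fc; rewrite -Rintegral_oc_cst//.
apply: (le_trans (normr_Rintegral_oc fi)).
apply: le_Rintegral => //; first exact: integrable_norm.
  exact: integrable_oc_cst.
by move=> z; rewrite /= in_itv/= => /andP[]; exact: fc.
Qed.

Lemma Rintegral_inv_sqrt c1 c2 a b : 0 < a -> a <= b ->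
  let f := fun z : R => c1 + c2 * (Num.sqrt z)^-1 in
  mu.-integrable `]a, b] (EFin \o f) /\
  Rintegral mu `]a, b] f = c1 * (b - a) + 2 * c2 * (Num.sqrt b - Num.sqrt a).
Proof.
move=> a0 ab f; pose F := c1 *: id + (2 * c2) *: (@Num.sqrt R) : R -> R.
have -> : c1 * (b - a) + 2 * c2 * (Num.sqrt b - Num.sqrt a) = F b - F a.
  by rewrite /F !fctE /GRing.scale/=; ring.
apply: (@Rintegral_FTC_oc f F a b a0 ab) => z z0.
- have D := is_deriveD (is_deriveZ c1 (is_derive_id z (1 : R)))
    (is_deriveZ (2 * c2) (is_derive1_sqrt z0)).
  refine (is_derive_eq D _); rewrite /f /GRing.scale/=.
  by field; rewrite sqrtr_eq0 -ltNge.
- have s0 : Num.sqrt z != 0 by rewrite sqrtr_eq0 -ltNge.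
  have D := is_deriveD (is_derive_cst c1 z (1 : R))
    (is_deriveZ c2 (@is_deriveV R (@Num.sqrt R) z _ 1 s0 (is_derive1_sqrt z0))).
  by case: D.
Qed.

End Integration.

(** * The fractional part, the kernel and their measurability *)

Section Kernel.
Variable R : realType.
Local Notation mu := (@lebesgue_measure R).
Local Notation frac := Defs.frac.
Implicit Types (x y z v a b : R).

(** A continuous primitive of [1/2 - frac v] away from the integers, vanishing at every integer;
    this is the function [A] of the overview. *)
Definition tri v : R := frac v * (1 - frac v) / 2.

Lemma frac_itv v : 0 <= frac v < 1.
Proof.
have /andP[h1 h2] := floor_itv v; move: h1 h2.
rewrite /frac intrD => h1 h2; apply/andP; split; lra.
Qed.

Lemma frac_eq (m : int) v : m%:~R <= v < m%:~R + 1 -> frac v = v - m%:~R.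
Proof. by move=> mv; rewrite /frac (@floor_def _ v m)// intrD. Qed.

(** The right endpoint, where [frac] jumps, is included because both sides vanish there. Boundary
    terms at jumps can thus be computed from either side. *)
Lemma tri_eq (m : int) v : m%:~R <= v <= m%:~R + 1 ->
  tri v = (v - m%:~R) * (1 - (v - m%:~R)) / 2.
Proof.
case/andP=> mv; rewrite le_eqVlt => /predU1P[vm|vm]; last first.
  by rewrite /tri (@frac_eq m) ?mv.
have fv : frac v = 0.
  rewrite (@frac_eq (m + 1)) intrD; first by rewrite vm subrr.
  apply/andP; split; lra.
by rewrite /tri fv vm; ring.
Qed.

Lemma tri_itv v : 0 <= tri v <= 8^-1.
Proof.
have /andP[f0 f1] := frac_itv v; rewrite /tri.
have h := sqr_ge0 (frac v - 2^-1); rewrite expr2 in h.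
by apply/andP; split; nra.
Qed.

Lemma KkerC x y : Kker x y = Kker y x.
Proof. by rewrite /Kker andbC mulrC. Qed.

Lemma Kker_norm x y : `|Kker x y| <= 2^-1.
Proof.
rewrite /Kker; case: ifP => _; last by rewrite normr0 invr_ge0.
have /andP[f0 f1] := frac_itv (x * y)^-1.
by rewrite ler_norml; apply/andP; split; lra.
Qed.

Lemma Kker_piece (m : int) x y : 0 < x -> 0 < y ->
  m%:~R <= (x * y)^-1 < m%:~R + 1 -> Kker x y = 2^-1 + m%:~R - (x * y)^-1.
Proof. by move=> x0 y0 h; rewrite /Kker x0 y0 (frac_eq h)/=; ring. Qed.

Lemma measurable_frac : measurable_fun setT (@frac R).
Proof.
apply: measurable_funB => //; apply: nondecreasing_measurable => // x y xy.
by rewrite ler_int le_floor.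
Qed.

Lemma measurable_Kker2 :
  measurable_fun setT (fun p : R * R => Kker p.1 p.2).
Proof.
(* Where both coordinates are positive, the inverse is the power of exponent -1, which is a
   measurable function. *)
pose h (p : R * R) : R := if (0 < p.1) && (0 < p.2)
  then 2^-1 - frac ((p.1 * p.2) `^ (-1)) else 0.
have -> : (fun p : R * R => Kker p.1 p.2) = h.
  apply/funext => -[x y]; rewrite /Kker /h/=; case: ifP => // /andP[x0 y0].
  by rewrite powR_inv1// mulr_ge0 ?ltW.
apply: measurable_fun_ifT => //.
  by apply: measurable_and; apply: measurable_fun_ltr.
apply: measurable_funB => //; apply: (measurableT_comp measurable_frac).
have mM : measurable_fun setT (fun p : R * R => p.1 * p.2).
  by apply: measurable_funM; [exact: measurable_fst|exact: measurable_snd].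
exact: (measurableT_comp (measurable_powR (-1)) mM).
Qed.

Lemma measurable_Kker x : measurable_fun setT (Kker x).
Proof. exact: (measurableT_comp measurable_Kker2 (pair1_measurable x)). Qed.

Lemma integrable_KkerM x (D : set R) f : measurable D ->
  mu.-integrable D (EFin \o f) ->
  mu.-integrable D (EFin \o (fun z => Kker x z * f z)).
Proof.
move=> mD fi.
have -> : EFin \o (fun z => Kker x z * f z) = ((EFin \o Kker x) \* (EFin \o f))%E.
  by apply/funext => z /=; rewrite EFinM.
apply: integrableMr => //.
- apply: measurable_funTS; exact: measurable_Kker.
- exists 2^-1; split=> [|e e2 z _ /=]; first exact: num_real.
  exact: (le_trans (Kker_norm _ _) (ltW e2)).
Qed.

End Kernel.

(** * Integration by parts against the oscillating kernel *)

Section Oscillation.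
Variable R : realType.
Local Notation mu := (@lebesgue_measure R).
Implicit Types (x y z a b c al be : R).

(* With [r z = al + be / z] one has [quad al be z = z ^+ 2 * r z], so that
   [- tri_quad x al be] is the boundary term of the integration by parts of
   [Kker x z * r z]. *)
Definition quad al be z : R := al * z ^+ 2 + be * z.
Definition tri_quad x al be z : R := x * tri (x * z)^-1 * quad al be z.

(** Integration by parts leaves the remainder [x * tri (x * z)^-1 * (2 * al * z + be)] under the
    integral, the last factor being the derivative of [quad]. Replacing [tri] by its bounds 0 and
    1/8 gives the two sides; both telescope when intervals are concatenated. *)
Definition ibp_bounds x al be a b :=
  tri_quad x al be a - tri_quad x al be b
    <= Rintegral mu `]a, b] (fun z => Kker x z * (al + be / z))
    <= tri_quad x al be a - tri_quad x al be b + x / 8 * (quad al be b - quad al be a).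

Lemma integrable_Kker_affine x al be a b : 0 < a -> a <= b ->
  mu.-integrable `]a, b] (EFin \o (fun z => Kker x z * (al + be / z))).
Proof.
move=> a0 ab; apply: integrable_KkerM => //.
have cf : {within `[a, b], continuous (fun z : R => al + be / z)}.
  apply: derivable_within_continuous => z; rewrite in_itv/= => /andP[az _].
  have z0 : 0 < z by exact: (lt_le_trans a0).
  have D := is_deriveD (is_derive_cst al z (1 : R))
    (is_deriveZ be (is_derive_inv_exp 1 z0)).
  by case: D.
apply: (@integrableS _ _ _ mu `[a, b]) => //; first exact: subset_itv_oc_cc.
by apply: continuous_compact_integrable => //; exact: segment_compact.
Qed.

(* On the interval considered [Kker x] has no jump, and [c1 z + c2 + c3 / z^2] is
   the derivative of [- tri_quad x al be]. *)
Lemma ibp_bounds_local (m : int) x al be a b : 0 < x -> 0 < a -> a <= b ->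
  m%:~R <= (x * b)^-1 -> (x * a)^-1 <= m%:~R + 1 ->
  0 <= al -> 0 <= 2 * al * a + be -> ibp_bounds x al be a b.
Proof.
move=> x0 a0 ab mb am al0 S'0.
set M : R := m%:~R in mb am.
have b0 : 0 < b by exact: lt_le_trans ab.
have xn0 : x != 0 by rewrite gt_eqF.
have inv_le z1 z2 : 0 < z1 -> z1 <= z2 -> (x * z2)^-1 <= (x * z1)^-1.
  move=> z10 z12; rewrite lef_pV2 ?posrE ?mulr_gt0 ?ler_pM2l//.
  exact: lt_le_trans z12.
have triE z : a <= z -> z <= b ->
    tri (x * z)^-1 = ((x * z)^-1 - M) * (1 - ((x * z)^-1 - M)) / 2.
  move=> az zb; apply: tri_eq; apply/andP; split.
    by apply: le_trans mb _; apply: inv_le => //; exact: lt_le_trans az.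
  by apply: le_trans am; exact: inv_le.
pose c1 := x * (M + M ^+ 2) * al.
pose c2 := - (2^-1 + M) * al + x * (M + M ^+ 2) * be / 2.
pose c3 := - be / (2 * x).
have [i1 E1] := @Rintegral_laurent R c1 c2 c3 a b a0 ab.
(* The added coefficients are those of [x / 8 * (2 * al * z + be)], the remainder with [tri]
   replaced by 1/8. *)
have [i2 E2] := @Rintegral_laurent R (c1 + x * al / 4) (c2 + x * be / 8) c3 a b a0 ab.
have KE z : a < z -> z <= b -> Kker x z * (al + be / z) =
    (c1 * z + c2 + c3 * z ^- 2) + x * tri (x * z)^-1 * (2 * al * z + be).
  move=> az zb; have z0 : 0 < z by exact: lt_trans az.
  have zn0 : z != 0 by rewrite gt_eqF.
  rewrite (@Kker_piece _ m)//; last first.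
    apply/andP; split.
      by apply: le_trans mb _; exact: inv_le.
    apply: lt_le_trans am.
    by rewrite ltf_pV2 ?posrE ?mulr_gt0 ?ltr_pM2l.
  rewrite triE// ?(ltW az)// /c1 /c2 /c3 -/M.
  by clear -xn0 zn0; clearbody M; field; rewrite xn0 zn0.
have i3 := @integrable_Kker_affine x al be a b a0 ab.
have an0 : a != 0 by rewrite gt_eqF.
have bn0 : b != 0 by rewrite gt_eqF.
rewrite /ibp_bounds; apply/andP; split.
- have <- : Rintegral mu `]a, b] (fun z => c1 * z + c2 + c3 * z ^- 2) = tri_quad x al be a - tri_quad x al be b.
    rewrite E1 /tri_quad !triE// /quad /c1 /c2 /c3.
    by clear -xn0 an0 bn0; clearbody M; field; rewrite xn0 an0 bn0.
  apply: le_Rintegral => // z; rewrite /= in_itv/= => /andP[az zb].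
  have /andP[t0 _] := tri_itv (x * z)^-1.
  rewrite KE// lerDl; apply: mulr_ge0; first by rewrite mulr_ge0// ltW.
  by apply: le_trans S'0 _; rewrite lerD2r ler_wpM2l ?(ltW az)// mulr_ge0.
- have <- : Rintegral mu `]a, b] (fun z => (c1 + x * al / 4) * z + (c2 + x * be / 8) + c3 * z ^- 2) = tri_quad x al be a - tri_quad x al be b + x / 8 * (quad al be b - quad al be a).
    rewrite E2 /tri_quad !triE// /quad /c1 /c2 /c3.
    by clear -xn0 an0 bn0; clearbody M; field; rewrite xn0 an0 bn0.
  apply: le_Rintegral => // z; rewrite /= in_itv/= => /andP[az zb].
  rewrite KE//.
  have S'z : 0 <= 2 * al * z + be.
    by apply: le_trans S'0 _; rewrite lerD2r ler_wpM2l ?(ltW az)// mulr_ge0.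
  have /andP[t0 t8] := tri_itv (x * z)^-1.
  have := mulr_ge0 (mulr_ge0 (ltW x0) S'z) (_ : 0 <= 8^-1 - tri (x * z)^-1).
  rewrite subr_ge0 => /(_ t8) h.
  rewrite -subr_ge0; move: h; congr (_ <= _); field.
  by rewrite gt_eqF// (lt_trans a0).
Qed.

Lemma ibp_bounds_cat x al be a b c : 0 < a -> a <= b -> b <= c ->
  ibp_bounds x al be a b -> ibp_bounds x al be b c -> ibp_bounds x al be a c.
Proof.
move=> a0 ab bc /andP[l1 u1] /andP[l2 u2].
have i := @integrable_Kker_affine x al be a c a0 (le_trans ab bc).
rewrite /ibp_bounds (Rintegral_oc_split ab bc i).
by apply/andP; split; lra.
Qed.

(** The jumps of [Kker x] are removed one at a time from the right, by induction on a bound [n] for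
    how far [(x * a)^-1] exceeds the unit interval containing [(x * b)^-1]. *)
Lemma ibp_boundsP x al be a b : 0 < x -> 0 < a -> a <= b ->
  0 <= al -> 0 <= 2 * al * a + be -> ibp_bounds x al be a b.
Proof.
move=> x0 a0 + al0 S'0.
have [n] : exists n : nat, (x * a)^-1 <= (Num.floor (x * b)^-1)%:~R + 1 + n%:R.
  exists (Num.bound `|(x * a)^-1 - ((Num.floor (x * b)^-1)%:~R + 1)|).
  by rewrite -lerBlDl (le_trans (ler_norm _))// ltW// archi_boundP.
elim: n b => [|n IH] b hn ab.
  apply: (@ibp_bounds_local (Num.floor (x * b)^-1)) => //.
    exact: floor_le.
  by rewrite addr0 in hn.
set m := Num.floor (x * b)^-1 in hn *.
have b0 : 0 < b by exact: lt_le_trans ab.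
have m0 : (0 : R) <= m%:~R by rewrite ler0z floor_ge0 invr_ge0 ltW// mulr_gt0.
have [am|am] := lerP (x * a)^-1 (m%:~R + 1).
  exact: (@ibp_bounds_local m) (floor_le _) am _ _.
(* This is the last jump of [Kker x] before [b]: there is none strictly between [c] and [b], and the
   induction hypothesis covers []a, c]]. *)
pose c := (x * (m%:~R + 1))^-1.
have m1 : (0 : R) < m%:~R + 1 by lra.
have c0 : 0 < c by rewrite invr_gt0 mulr_gt0.
have xc : (x * c)^-1 = m%:~R + 1 by rewrite /c; field; rewrite !gt_eqF.
have ac : a <= c.
  by rewrite -(ler_pM2l x0) -[leLHS]invrK -[leRHS]invrK lef_pV2 ?posrE ?invr_gt0 ?mulr_gt0// xc ltW.
have cb : c <= b.
  rewrite -(ler_pM2l x0) -[leLHS]invrK -[leRHS]invrK lef_pV2 ?posrE ?invr_gt0 ?mulr_gt0// xc.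
  by have /andP[_ /ltW] := floor_itv (x * b)^-1; rewrite intrD.
apply: (ibp_bounds_cat a0 ac cb).
  apply: IH => //; rewrite xc.
  have -> : Num.floor (m%:~R + 1 : R) = m + 1 by rewrite -(intrD _ m 1) intrKfloor.
  by rewrite intrD; move: hn; rewrite -natr1; lra.
apply: (@ibp_bounds_local m) => //.
- exact: floor_le.
- by rewrite xc.
- by apply: le_trans S'0 _; rewrite lerD2r ler_wpM2l// mulr_ge0.
Qed.

End Oscillation.

(** * Pointwise bounds for the iterated kernel *)

Section IteratedKernel.
Variable R : realType.
Local Notation mu := (@lebesgue_measure R).
Implicit Types (x y z a b : R).

Definition K2 x y : R := Rintegral mu `]0, 1] (fun z => Kker x z * Kker y z).

Lemma integrable_Kker x a b : mu.-integrable `]a, b] (EFin \o Kker x).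
Proof.
have -> : Kker x = (fun z => Kker x z * (cst 1 z)) by apply/funext => z; rewrite mulr1.
by apply: integrable_KkerM => //; exact: integrable_oc_cst.
Qed.

Lemma integrable_KkerK x y a b :
  mu.-integrable `]a, b] (EFin \o (fun z => Kker x z * Kker y z)).
Proof. by apply: integrable_KkerM => //; exact: integrable_Kker. Qed.

Lemma KkerK_norm x y z : `|Kker x z * Kker y z| <= 4^-1.
Proof.
rewrite normrM; have h := ler_pM (normr_ge0 _) (normr_ge0 _) (Kker_norm x z) (Kker_norm y z).
by apply: (le_trans h); lra.
Qed.

Lemma K2_norm x y : `|K2 x y| <= 4^-1.
Proof.
have := @Rintegral_oc_bound R (fun z => Kker x z * Kker y z) 4^-1 0 1 ler01
  (integrable_KkerK _ _ _ _) (fun z _ _ => KkerK_norm x y z).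
by rewrite subr0 mulr1.
Qed.

(** Here [Kker y z] is [al + be / z] with [al = 1/2 + n] and [be = - 1/y], so [quad al be z] is
    [z ^+ 2 * Kker y z], of size at most [z ^+ 2 / 2]; with [tri <= 1/8] this gives the factor 1/16.
    The end [b] is free because the rightmost piece stops at 1, which need not be a jump. *)
Lemma KkerK_piece x y (n : nat) b : 0 < x -> 0 < y ->
  let a := (n.+1%:R * y)^-1 in a <= b -> n%:R <= (y * b)^-1 ->
  `|Rintegral mu `]a, b] (fun z => Kker x z * Kker y z)| <= x / 16 * (a ^+ 2 + b ^+ 2).
Proof.
move=> x0 y0 a ab nb.
have n0 : (0 : R) <= n%:R by rewrite ler0n.
have n1 : (0 : R) < n%:R + 1 by lra.
have aE : a = ((n%:R + 1) * y)^-1 by rewrite /a natr1.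
have a0 : 0 < a by rewrite aE invr_gt0 mulr_gt0.
have b0 : 0 < b by exact: lt_le_trans ab.
have yn0 : y != 0 by rewrite gt_eqF.
have bn0 : b != 0 by rewrite gt_eqF.
have ya : (y * a)^-1 = n%:R + 1 by rewrite aE; field; rewrite yn0 gt_eqF.
pose al : R := 2^-1 + n%:R; pose be := - y^-1.
have -> : Rintegral mu `]a, b] (fun z => Kker x z * Kker y z) =
          Rintegral mu `]a, b] (fun z => Kker x z * (al + be / z)).
  apply: eq_Rintegral => z; rewrite inE/= in_itv/= => /andP[az zb].
  have z0 : 0 < z by exact: lt_trans az.
  rewrite (@Kker_piece _ n y z)//; last first.
    rewrite -pmulrn -ya; apply/andP; split.
      by apply: (le_trans nb); rewrite lef_pV2 ?posrE ?mulr_gt0// ler_pM2l.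
    by rewrite ltf_pV2 ?posrE ?mulr_gt0// ltr_pM2l.
  rewrite -pmulrn /al /be invfM; congr (_ * _); ring.
have := @ibp_boundsP R x al be a b x0 a0 ab.
have al0 : 0 <= al by rewrite /al; lra.
move=> /(_ al0) /(_ _)/andP; case.
  rewrite /al /be aE.
  (* The derivative of [quad] at [a] is [n * a], nonnegative even for [n = 0]. *)
  have -> : 2 * (2^-1 + n%:R) * ((n%:R + 1) * y)^-1 + - y^-1 = n%:R * ((n%:R + 1) * y)^-1.
    by field; rewrite yn0 gt_eqF.
  by rewrite mulr_ge0// -aE ltW.
have Sa : al * a ^+ 2 + be * a = - (a ^+ 2) / 2.
  by rewrite /al /be aE; field; rewrite yn0 gt_eqF.
(* The value of [al + be / z] at [b]; at [a] that value is -1/2, whence [Sa]. *)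
pose ka := al - (y * b)^-1.
have Sb : al * b ^+ 2 + be * b = ka * b ^+ 2.
  by rewrite /ka /be; field; rewrite yn0 bn0.
have kab : - 2^-1 <= ka <= 2^-1.
  have : (y * b)^-1 <= n%:R + 1.
    by rewrite -ya lef_pV2 ?posrE ?mulr_gt0// ler_pM2l.
  by move=> h; rewrite /ka /al; apply/andP; split; lra.
rewrite /tri_quad /quad Sa Sb.
have /andP[ta0 ta1] := tri_itv (x * a)^-1.
have /andP[tb0 tb1] := tri_itv (x * b)^-1.
set ta := tri (x * a)^-1 in ta0 ta1 *; set tb := tri (x * b)^-1 in tb0 tb1 *.
have /andP[k0 k1] := kab.
have a2 := sqr_ge0 a; have b2 := sqr_ge0 b.
set A := a ^+ 2 in a2 *; set B := b ^+ 2 in b2 *.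
have xA : 0 <= x * A by rewrite mulr_ge0// ltW.
have xB : 0 <= x * B by rewrite mulr_ge0// ltW.
have h1 : x * ta * (- A / 2) = - (x * A) * ta / 2 by ring.
have h2 : x * tb * (ka * B) = (x * B) * (tb * ka) by ring.
have h3 : x / 8 * (ka * B - - A / 2) = (x * B) * ka / 8 + (x * A) / 16 by field.
have h4 : x / 16 * (A + B) = (x * A) / 16 + (x * B) / 16 by ring.
rewrite h1 h2 h3 h4.
have t1 : (x * A) * ta <= (x * A) / 8 by rewrite ler_wpM2l.
have t2 : 0 <= (x * A) * ta by rewrite mulr_ge0.
have t3 : (x * B) * (tb * ka) <= (x * B) / 16 by rewrite ler_wpM2l//; nra.
have t4 : (x * B) * (ka / 8 - tb * ka) <= (x * B) / 16 by rewrite ler_wpM2l//; nra.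
rewrite mulrBr mulrA in t4.
by move=> lo hi; rewrite ler_norml; apply/andP; split; lra.
Qed.

(* The bound is arranged so that the induction on [j] closes by
   [1 / (k + 1) ^ 2 <= 1 / k - 1 / (k + 1)]. *)
Lemma KkerK_tail x y (N j : nat) (k : R) : 0 < x -> 0 < y -> y <= 1 ->
  N%:R <= y^-1 < N%:R + 1 ->
  k = (N + j)%:R + 1 ->
  `|Rintegral mu `](k * y)^-1, 1] (fun z => Kker x z * Kker y z)|
    <= x / 16 * (1 + (2 * (N%:R + 1) ^- 2 + 2 * (N%:R + 1)^-1 - 2 * k^-1 - k ^- 2) / y ^+ 2).
Proof.
move=> x0 y0 y1 /andP[Ny yN].
have yn0 : y != 0 by rewrite gt_eqF.
elim: j k => [|j IH] k kdef.
  rewrite {}kdef addn0 natr1.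
  have h1 : (N.+1%:R * y)^-1 <= 1.
    by rewrite invf_le1 ?mulr_gt0// -natr1 -ler_pdivrMr// div1r ltW.
  have := @KkerK_piece x y N 1 x0 y0 h1.
  rewrite mulr1 => /(_ Ny) /le_trans; apply.
  by rewrite ler_pM2l ?divr_gt0// expr1n addrC lerD2l le_eqVlt; apply/orP; left; apply/eqP;
    field; rewrite yn0 /= ?natr1 ?nat1r pnatr_eq0.
set l : R := (N + j)%:R + 1 in IH.
have {}IH := IH l erefl.
have l0 : 0 < l by rewrite /l ltr_wpDl.
have kE : k = l + 1 by rewrite kdef /l addnS -natr1.
have k0 : 0 < k by rewrite kE; lra.
have kl : (k * y)^-1 <= (l * y)^-1.
  by rewrite lef_pV2 ?posrE ?mulr_gt0// ler_pM2r// kE; lra.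
have l1 : (l * y)^-1 <= 1.
  rewrite invf_le1 ?mulr_gt0// -ler_pdivrMr// div1r (le_trans (ltW yN))//.
  by rewrite /l lerD2r ler_nat leq_addr.
rewrite (Rintegral_oc_split kl l1 (integrable_KkerK _ _ _ _)).
apply: (le_trans (ler_normD _ _)).
have P := @KkerK_piece x y (N + j).+1 (l * y)^-1 x0 y0.
have e1 : (N + j).+2%:R = k :> R by rewrite kdef -natr1 addnS.
have e2 : (N + j).+1%:R = l :> R by rewrite /l natr1.
rewrite /= e1 e2 in P.
have {}P := P kl _; rewrite [X in _ <= X](_ : _ = l) in P; last by field; rewrite yn0 gt_eqF.
have {}P := P (lexx _).
apply: (le_trans (lerD P IH)); rewrite -mulrDr ler_pM2l ?divr_gt0//.
(* The slack is [2 / y ^+ 2] times [1/l - 1/(l + 1) - 1/(l + 1)^2]. Squares occur twice because an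
   interior jump ends two pieces. *)
rewrite -subr_ge0 kE.
have -> : forall u : R, 1 + (u - 2 * (l + 1)^-1 - (l + 1) ^- 2) / y ^+ 2 -
   ((((l + 1) * y)^-1) ^+ 2 + ((l * y)^-1) ^+ 2 + (1 + (u - 2 * l^-1 - l ^- 2) / y ^+ 2)) =
   2 / (l * (l + 1) ^+ 2 * y ^+ 2).
  by move=> u; field; rewrite yn0 !gt_eqF// -kE.
by rewrite -kE divr_ge0// ltW// !mulr_gt0// exprn_gt0.
Qed.

(** The finite sums of [KkerK_tail] reach down to [(k * y)^-1]; the rest is at most
    [(4 * k * y)^-1], which is made small. Since [1/(N + 1) <= y], the tail is at most
    [x/16 * (1 + 2 + 2/y)]. *)
Lemma K2_le x y : 0 < x -> 0 < y -> y <= 1 ->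
  `|K2 x y| <= 3 / 16 * x + 8^-1 * (x / y).
Proof.
move=> x0 y0 y1.
have yn0 : y != 0 by rewrite gt_eqF.
pose N := Num.truncn y^-1.
have Ny : N%:R <= y^-1 < N%:R + 1.
  by rewrite natr1; apply: truncn_itv; rewrite invr_ge0 ltW.
have N1 : (0 : R) < N%:R + 1 by rewrite ltr_wpDl.
apply/ler_addgt0Pr => e e0.
(* Large enough for the integral over []0, (k * y)^-1]] to be at most [e]. *)
pose j := Num.bound (4 * y * e)^-1.
pose k : R := (N + j)%:R + 1.
have k0 : 0 < k by rewrite /k ltr_wpDl.
have jk : (4 * y * e)^-1 <= k.
  apply: ltW; apply: (lt_le_trans (archi_boundP _)).
    by rewrite invr_ge0 ltW// !mulr_gt0.
  by rewrite /k natr1 ler_nat (leq_trans (leq_addl N _)).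
have u0 : 0 < (k * y)^-1 by rewrite invr_gt0 mulr_gt0.
have u1 : (k * y)^-1 <= 1.
  rewrite invf_le1 ?mulr_gt0// -ler_pdivrMr// div1r.
  have /andP[_ /ltW h] := Ny; apply: (le_trans h).
  by rewrite /k lerD2r ler_nat leq_addr.
rewrite /K2 (Rintegral_oc_split (ltW u0) u1 (integrable_KkerK _ _ _ _)).
apply: (le_trans (ler_normD _ _)); rewrite addrC; apply: lerD.
  apply: (le_trans (KkerK_tail x0 y0 y1 Ny (erefl k))).
  have /andP[_ h] := Ny.
  set u := (N%:R + 1)^-1.
  have un0 : 0 < u by rewrite invr_gt0.
  have uy : u <= y by rewrite -[y]invrK lef_pV2 ?posrE ?invr_gt0// ltW.
  have -> : 3 / 16 * x + 8^-1 * (x / y) = x / 16 * (1 + (2 * y ^+ 2 + 2 * y) / y ^+ 2).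
    by field.
  rewrite ler_pM2l ?divr_gt0// lerD2l ler_pM2r ?invr_gt0 ?exprn_gt0//.
  have k1 : 0 <= k^-1 by rewrite invr_ge0 ltW.
  have k2 : 0 <= k ^- 2 by rewrite invr_ge0 sqr_ge0.
  have u2 : (N%:R + 1) ^- 2 <= y ^+ 2.
    by rewrite -exprVn -/u ler_sqr ?nnegrE// ltW.
  by lra.
apply: (le_trans (@Rintegral_oc_bound R _ 4^-1 _ _ (ltW u0) (integrable_KkerK _ _ _ _) (fun z _ _ => KkerK_norm x y z))).
rewrite subr0.
have -> : 4^-1 * (k * y)^-1 = (4 * y * e)^-1 / k * e.
  by field; rewrite yn0 !gt_eqF.
by rewrite ger_pMl// ler_pdivrMr// mul1r.
Qed.

Lemma K2_le_ratio x y : 0 < x -> 0 < y -> y <= 1 -> `|K2 x y| <= 5 / 16 * (x / y).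
Proof.
move=> x0 y0 y1; apply: (le_trans (K2_le x0 y0 y1)).
have : x <= x / y by rewrite ler_pdivlMr// ger_pMr.
lra.
Qed.

End IteratedKernel.

(** * Fubini and the iterated integral operator *)

Section FubiniKernel.
Variable R : realType.
Local Notation mu := (@lebesgue_measure R).
Implicit Types k psi : R -> R.

Lemma integrable_prod_EFin k psi :
  mu.-integrable setT (EFin \o k) -> mu.-integrable setT (EFin \o psi) ->
  (mu \x mu)%E.-integrable setT (EFin \o (fun p : R * R => psi p.1 * k p.2)).
Proof.
move=> ik ipsi.
have mk : measurable_fun setT k by apply/measurable_EFinP; exact: measurable_int ik.
have mpsi : measurable_fun setT psi by apply/measurable_EFinP; exact: measurable_int ipsi.
apply/integrable12ltyP.
  apply/measurable_EFinP; apply: measurable_funM.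
    exact: (measurableT_comp mpsi (@measurable_fst _ _ R R)).
  exact: (measurableT_comp mk (@measurable_snd _ _ R R)).
have ink : mu.-integrable setT (EFin \o (fun y => `|k y|)) by exact: integrable_norm.
have inpsi : mu.-integrable setT (EFin \o (fun y => `|psi y|)) by exact: integrable_norm.
rewrite (_ : (fun x => _) = (fun x => (Rintegral mu setT (fun y => `|k y|))%:E * (`|psi x|)%:E)%E); last first.
  apply/funext => z /=.
  under eq_integral do rewrite normrM EFinM.
  by rewrite integralZl// muleC; congr (_ * _)%E; rewrite fineK//; exact: integrable_fin_num.
rewrite integralZl//.
have : (\int[mu]_y (`|psi y|)%:E)%E \is a fin_num by exact: integrable_fin_num.
by move/fineK <-; rewrite -EFinM ltry.
Qed.

(** The integrand [Kker z y * psi z * k y] is integrable on the plane because the kernel is bounded;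
    symmetry of the kernel gives both inner integrals the same form. The domain is the whole line,
    and []0, 1]] is recovered by restricting [k] and [psi]. *)
Lemma Fubini_Kker k psi :
  mu.-integrable setT (EFin \o k) -> mu.-integrable setT (EFin \o psi) ->
  mu.-integrable setT (EFin \o (fun z => Rintegral mu setT (fun y => Kker z y * k y) * psi z)) /\
  Rintegral mu setT (fun y => Rintegral mu setT (fun z => Kker y z * psi z) * k y) =
  Rintegral mu setT (fun z => Rintegral mu setT (fun y => Kker z y * k y) * psi z).
Proof.
move=> ik ipsi.
pose h (p : R * R) : R := Kker p.1 p.2 * (psi p.1 * k p.2).
have ih : (mu \x mu)%E.-integrable setT (EFin \o h).
  have -> : EFin \o h = ((EFin \o (fun p : R * R => Kker p.1 p.2)) \*
      (EFin \o (fun p : R * R => psi p.1 * k p.2)%R))%E.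
    by apply/funext => p /=; rewrite -EFinM.
  apply: integrableMr => //.
  - exact: measurable_Kker2.
  - exists 2^-1; split=> [|e e2 z _ /=]; first exact: num_real.
    exact: (le_trans (Kker_norm _ _) (ltW e2)).
  - exact: integrable_prod_EFin.
have F1 z : (\int[mu]_y (h (z, y))%:E)%E =
    (Rintegral mu setT (fun y => Kker z y * k y) * psi z)%:E.
  under eq_integral do rewrite /h/= mulrCA EFinM.
  rewrite integralZl//; last exact: integrable_KkerM.
  rewrite muleC EFinM; congr (_ * _)%E; rewrite fineK//.
  by apply: integrable_fin_num => //; exact: integrable_KkerM.
have F2 y : (\int[mu]_z (h (z, y))%:E)%E =
    (Rintegral mu setT (fun z => Kker y z * psi z) * k y)%:E.
  under eq_integral do rewrite /h/= mulrA mulrC KkerC EFinM.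
  rewrite integralZl//; last exact: integrable_KkerM.
  rewrite muleC EFinM; congr (_ * _)%E; rewrite fineK//.
  by apply: integrable_fin_num => //; exact: integrable_KkerM.
split.
  have -> : EFin \o (fun z => Rintegral mu setT (fun y => Kker z y * k y) * psi z) =
      fubini_F mu (EFin \o h) by apply/funext => z; rewrite /= -F1.
  exact: integrable_fubini_F ih.
rewrite /Rintegral; congr fine.
transitivity (\int[mu]_y \int[mu]_z (h (z, y))%:E)%E.
  by apply: eq_integral => y _; rewrite F2.
transitivity (\int[mu]_z \int[mu]_y (h (z, y))%:E)%E.
  by rewrite (Fubini ih).
by apply: eq_integral => z _; rewrite F1.
Qed.

Lemma Rintegral_Kker_iterate x (phi : R -> R) :
  mu.-integrable `]0, 1] (EFin \o phi) ->
  mu.-integrable `]0, 1] (EFin \o (fun z => K2 x z * phi z)) /\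
  Rintegral mu `]0, 1]
    (fun y => Kker x y * Rintegral mu `]0, 1] (fun z => Kker y z * phi z)) =
  Rintegral mu `]0, 1] (fun z => K2 x z * phi z).
Proof.
move=> iphi; pose D : set R := `]0, 1]%classic.
have mD : measurable D by exact: measurable_itv.
have ik : mu.-integrable D (EFin \o Kker x) := integrable_Kker x 0 1.
have ik' : mu.-integrable setT (EFin \o (Kker x \_ D)).
  by rewrite -restrict_EFin; apply/integrable_restrict; rewrite ?setTI.
have iphi' : mu.-integrable setT (EFin \o (phi \_ D)).
  by rewrite -restrict_EFin; apply/integrable_restrict; rewrite ?setTI.
have [i E] := Fubini_Kker ik' iphi'.
have patchM (f g : R -> R) : (fun z => f z * (g \_ D) z) = (fun z => f z * g z) \_ D.
  by apply/funext => z; rewrite !patchE; case: ifP => _ //; rewrite mulr0.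
have KE z : Rintegral mu setT (fun y => Kker z y * (Kker x \_ D) y) = K2 x z.
  rewrite patchM -Rintegral_mkcond; apply: eq_Rintegral => y _; rewrite mulrC.
  by [].
have GE y : Rintegral mu setT (fun z => Kker y z * (phi \_ D) z) =
    Rintegral mu D (fun z => Kker y z * phi z).
  by rewrite patchM -Rintegral_mkcond.
split.
  rewrite -[`]0, 1]%classic]setTI; apply/integrable_restrict => //; rewrite restrict_EFin -patchM.
  suff -> : (fun z => K2 x z * (phi \_ D) z) =
    (fun z => Rintegral mu setT (fun y => Kker z y * (Kker x \_ D) y) * (phi \_ D) z) by [].
  by apply/funext => z; rewrite KE.
rewrite [RHS]Rintegral_mkcond -patchM.
transitivity (Rintegral mu setT (fun y =>
    Rintegral mu setT (fun z => Kker y z * (phi \_ D) z) * (Kker x \_ D) y)).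
  rewrite patchM -Rintegral_mkcond; apply: eq_Rintegral => y _.
  by rewrite GE mulrC.
by rewrite E; apply: eq_Rintegral => z _; rewrite KE.
Qed.

End FubiniKernel.

(** * Bounds for a normalised eigenfunction *)

Section Eigenfunction.
Variable R : realType.
Local Notation mu := (@lebesgue_measure R).
Variables (phi : R -> R) (lam : R).
Hypothesis phi_eigen : eigenfun phi lam.
Hypothesis phi_unit : ip phi phi = 1.
Hypothesis lam_neq0 : lam != 0.
Implicit Types (x z a b : R).

Let itv01_sub : `]0, 1]%classic `<=` @unitI R.
Proof. exact: subset_itv_oc_cc. Qed.

Let mphi : measurable_fun (`]0, 1]%classic : set R) phi.
Proof.
have [[m _] _] := phi_eigen; apply: measurable_funS itv01_sub m => //.
exact: measurable_itv.
Qed.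

Lemma integrable_eigenfun_sqr : mu.-integrable `]0, 1] (EFin \o (fun z => phi z ^+ 2)).
Proof.
have [[_ i] _] := phi_eigen.
apply: (@integrableS _ _ _ mu (@unitI R)) => //; exact: measurable_itv.
Qed.

Lemma integrable_eigenfun : mu.-integrable `]0, 1] (EFin \o phi).
Proof.
apply: (@le_integrable _ _ _ mu _ _ _ (EFin \o (fun z => 1 + phi z ^+ 2))) => //.
- exact/measurable_EFinP.
- move=> z _ /=; rewrite lee_fin [leRHS]ger0_norm; last by rewrite addr_ge0// sqr_ge0.
  rewrite -[phi z ^+ 2]real_normK ?num_real//.
  have := sqr_ge0 (`|phi z| - 1); rewrite !expr2; have := normr_ge0 (phi z); nra.
- have -> : EFin \o (fun z => 1 + phi z ^+ 2) =
    ((EFin \o cst 1%R) \+ (EFin \o (fun z => phi z ^+ 2)%R))%E by [].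
  by apply: integrableD => //; [exact: integrable_oc_cst|exact: integrable_eigenfun_sqr].
Qed.

Definition mass a b : R := Rintegral mu `]a, b] (fun z => phi z ^+ 2).

Lemma mass01 : mass 0 1 = 1.
Proof.
rewrite -[RHS]phi_unit /ip /mass Rintegral_itv_obnd_cbnd//; exact: integrable_eigenfun_sqr.
Qed.

Lemma mass_split a b c : 0 <= a -> a <= b -> b <= c -> c <= 1 ->
  mass a c = mass a b + mass b c.
Proof.
move=> a0 ab bc c1; apply: Rintegral_oc_split => //.
exact: integrable_oc_sub integrable_eigenfun_sqr.
Qed.

Lemma mass_ge0 a b : 0 <= mass a b.
Proof. by apply: Rintegral_ge0 => z _; exact: sqr_ge0. Qed.

(** This stands in for Cauchy-Schwarz: a pointwise AM-GM inequality separates a multiple of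
    [phi ^+ 2], charged to the [mass] of the interval, from an explicit function [f]. *)
Lemma Rintegral_le_mass (g f : R -> R) B a b : 0 <= a -> b <= 1 ->
  mu.-integrable `]0, 1] (EFin \o g) ->
  mu.-integrable `]a, b] (EFin \o f) ->
  (forall z, a < z -> z <= b -> `|g z| <= B * phi z ^+ 2 + f z) ->
  Rintegral mu `]a, b] (fun z => `|g z|) <= B * mass a b + Rintegral mu `]a, b] f.
Proof.
move=> a0 b1 ig if_ gf.
have is_ := integrable_oc_sub a0 b1 integrable_eigenfun_sqr.
have iB : mu.-integrable `]a, b] (EFin \o (fun z => B * phi z ^+ 2)).
  have -> : EFin \o (fun z => B * phi z ^+ 2) =
    (fun z => B%:E * (EFin \o (fun z => phi z ^+ 2)%R) z)%E by [].
  exact: integrableZl.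
rewrite -RintegralZl// -RintegralD//.
apply: le_Rintegral => //.
- by apply: integrable_norm; exact: integrable_oc_sub ig.
- have -> : EFin \o (fun z => B * phi z ^+ 2 + f z) =
    ((EFin \o (fun z => B * phi z ^+ 2)%R) \+ (EFin \o f))%E by [].
  exact: integrableD.
- by move=> z; rewrite /= in_itv/= => /andP[]; exact: gf.
Qed.

Lemma eigenfunE x : 0 <= x -> x <= 1 ->
  phi x = lam * Rintegral mu `]0, 1] (fun y => Kker x y * phi y).
Proof.
move=> x0 x1; have [_ [_ E]] := phi_eigen.
rewrite E; last by apply/mem_set; rewrite /unitI/= in_itv/= x0.
rewrite Rintegral_itv_obnd_cbnd//.
by apply: integrable_KkerM; [exact: measurable_itv|exact: integrable_eigenfun].
Qed.

Lemma eigenfunE2 x : 0 <= x -> x <= 1 ->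
  phi x = lam ^+ 2 * Rintegral mu `]0, 1] (fun y => K2 x y * phi y).
Proof.
move=> x0 x1; rewrite eigenfunE// expr2 -mulrA; congr (_ * _).
have [_ <-] := Rintegral_Kker_iterate x integrable_eigenfun.
have mD : measurable (`]0, 1]%classic : set R) by exact: measurable_itv.
have -> : Rintegral mu `]0, 1]
    (fun y => Kker x y * Rintegral mu `]0, 1] (fun z => Kker y z * phi z)) =
  Rintegral mu `]0, 1] (fun y => lam^-1 * (Kker x y * phi y)).
  apply: eq_Rintegral => y; rewrite inE/= in_itv/= => /andP[y0 y1].
  by rewrite (eigenfunE (ltW y0) y1) mulrCA mulKf.
rewrite RintegralZl//; last exact: integrable_KkerM integrable_eigenfun.
by rewrite mulVKf.
Qed.

(** From [|Kker x z * phi z| <= (1 + phi z ^+ 2) / 4] and total mass 1. *)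
Lemma eigenfun_norm x : 0 <= x -> x <= 1 -> `|phi x| <= `|lam| / 2.
Proof.
move=> x0 x1; rewrite eigenfunE// normrM ler_wpM2l//.
have mD : measurable (`]0, 1]%classic : set R) by exact: measurable_itv.
have i := integrable_KkerM x mD integrable_eigenfun.
apply: (le_trans (normr_Rintegral_oc i)).
have := @Rintegral_le_mass (fun y => Kker x y * phi y) (cst 4^-1) 4^-1 0 1 (lexx _) (lexx _) i
  (integrable_oc_cst _ _ _).
rewrite mass01 Rintegral_oc_cst// => H; apply: (le_trans (H _)); last by lra.
move=> z _ _ /=; rewrite normrM.
have h := ler_wpM2r (normr_ge0 (phi z)) (Kker_norm x z).
rewrite -[phi z ^+ 2]real_normK ?num_real//.
have := sqr_ge0 (`|phi z| - 1); rewrite !expr2; nra.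
Qed.

(** Squaring and integrating the uniform bound gives [1 <= (|lam| / 2)^2]. *)
Lemma eigenvalue_ge2 : 2 <= `|lam|.
Proof.
have : mass 0 1 <= (`|lam| / 2) ^+ 2.
  have -> : (`|lam| / 2) ^+ 2 = Rintegral mu `]0, 1] (cst ((`|lam| / 2) ^+ 2)).
    by rewrite Rintegral_oc_cst// subr0 mulr1.
  apply: le_Rintegral => //; [exact: integrable_eigenfun_sqr|exact: integrable_oc_cst|].
  move=> z; rewrite /= in_itv/= => /andP[z0 z1].
  rewrite -[phi z ^+ 2]real_normK ?num_real// ler_sqr ?nnegrE ?divr_ge0//.
  exact: eigenfun_norm (ltW z0) z1.
rewrite mass01 -[leLHS](expr1n _ 2) ler_sqr ?nnegrE ?divr_ge0// => h.
by lra.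
Qed.

Lemma K2_AMGM x z t : 0 < t ->
  `|K2 x z * phi z| <= t / 2 * phi z ^+ 2 + K2 x z ^+ 2 / (2 * t).
Proof.
move=> t0; rewrite normrM -[phi z ^+ 2]real_normK ?num_real//.
rewrite -[K2 x z ^+ 2]real_normK ?num_real// -subr_ge0.
have -> : t / 2 * `|phi z| ^+ 2 + `|K2 x z| ^+ 2 / (2 * t) - `|K2 x z| * `|phi z|
   = (t * `|phi z| - `|K2 x z|) ^+ 2 / (2 * t).
  by field; rewrite gt_eqF.
by rewrite divr_ge0 ?sqr_ge0// mulr_ge0// ltW.
Qed.

Lemma eigenfun_sqrt x : 0 < x -> x <= 1 ->
  `|phi x| <= lam ^+ 2 * (5 / 12 * Num.sqrt x).
Proof.
move=> x0 x1; rewrite (eigenfunE2 (ltW x0) x1) normrM ger0_norm ?sqr_ge0//.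
rewrite ler_wpM2l ?sqr_ge0//.
have [i _] := Rintegral_Kker_iterate x integrable_eigenfun.
have mD : measurable (`]0, 1]%classic : set R) by exact: measurable_itv.
apply: (le_trans (normr_Rintegral_oc i)).
rewrite (Rintegral_oc_split (ltW x0) x1)//; last exact: integrable_norm.
set s := Num.sqrt x; have s0 : 0 < s by rewrite sqrtr_gt0.
have sx : x = s ^+ 2 by rewrite sqr_sqrtr// ltW.
(* The bounds 1/4 below [x] and [5 x / (16 z)] above it make the integral of [K2 x z ^+ 2] at most
   [41 x / 256]. The best [t] would be [sqrt 41 / 16 * s]; 5/12 is a nearby rational coefficient
   that still meets the target. *)
pose t := 5 / 12 * s; have t0 : 0 < t by rewrite mulr_gt0.
pose d := 25 / 256 * x ^+ 2 / (2 * t).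
have [i2 E2] := @Rintegral_laurent R 0 0 d x 1 x0 x1.
have H1 := @Rintegral_le_mass (fun z => K2 x z * phi z) (cst (32 * t)^-1) (t / 2)
  0 x (lexx _) x1 i (integrable_oc_cst _ _ _).
have H2 := @Rintegral_le_mass (fun z => K2 x z * phi z) _ (t / 2)
  x 1 (ltW x0) (lexx _) i i2.
rewrite E2 in H2; rewrite Rintegral_oc_cst ?(ltW x0)// in H1.
apply: (le_trans (lerD (H1 _) (H2 _))).
- move=> z z0 zx; apply: (le_trans (K2_AMGM x z t0)); rewrite lerD2l /=.
  have -> : (32 * t)^-1 = (4^-1) ^+ 2 / (2 * t) by field; rewrite gt_eqF.
  rewrite ler_pM2r ?invr_gt0 ?mulr_gt0//.
  by rewrite -[K2 x z ^+ 2]real_normK ?num_real// ler_sqr ?nnegrE// K2_norm.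
- move=> z xz z1; apply: (le_trans (K2_AMGM x z t0)); rewrite lerD2l /=.
  have z0 : 0 < z by exact: lt_trans xz.
  have -> : 0 * z + 0 + d * z ^- 2 = (5 / 16 * (x / z)) ^+ 2 / (2 * t).
    by rewrite /d; field; rewrite !gt_eqF.
  rewrite ler_pM2r ?invr_gt0 ?mulr_gt0//.
  rewrite -[K2 x z ^+ 2]real_normK ?num_real// ler_sqr ?nnegrE//; last first.
    by rewrite mulr_ge0// divr_ge0// ltW.
  exact: K2_le_ratio.
have := mass_split (lexx 0) (ltW x0) x1 (lexx 1); rewrite mass01 => m1.
have -> : t / 2 * mass 0 x + (32 * t)^-1 * (x - 0) +
  (t / 2 * mass x 1 + (0 * 1 ^+ 2 / 2 + 0 * 1 - d * 1^-1 - (0 * x ^+ 2 / 2 + 0 * x - d * x^-1)))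
  = t / 2 * (mass 0 x + mass x 1) + (32 * t)^-1 * x + d * x^-1 - d.
  by rewrite invr1; ring.
rewrite -m1 mulr1.
have d0 : 0 <= d by rewrite /d divr_ge0// ?mulr_ge0// ?sqr_ge0// ltW.
have -> : (32 * t)^-1 * x = 3 / 40 * s.
  by rewrite /t sx; field; rewrite gt_eqF.
have -> : d * x^-1 = 15 / 128 * s.
  by rewrite /d /t sx; field; rewrite gt_eqF.
rewrite /t in d0 *; lra.
Qed.

(** The cut at [eta] keeps [1 / sqrt z] away from 0; below it the crude bound [|lam| / 8] suffices.
    In the coefficient 11/48, the middle range contributes 5/48 and the range above [lam ^- 2]
    contributes 1/16 twice. *)
Lemma eigenfun_trunc x eta : 0 < x -> x <= 1 -> 0 < eta -> eta <= lam ^- 2 ->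
  `|phi x| <= lam ^+ 2 * (`|lam| / 8 * eta + x * (3 / 16 + 11 / 48 * `|lam|)).
Proof.
move=> x0 x1 e0 ed; rewrite (eigenfunE2 (ltW x0) x1) normrM ger0_norm ?sqr_ge0//.
rewrite ler_wpM2l ?sqr_ge0//.
have [i _] := Rintegral_Kker_iterate x integrable_eigenfun.
have mD : measurable (`]0, 1]%classic : set R) by exact: measurable_itv.
apply: (le_trans (normr_Rintegral_oc i)).
set L := `|lam|; have L2 : 2 <= L := eigenvalue_ge2.
have L0 : 0 < L by lra.
have lamL : lam ^+ 2 = L ^+ 2 by rewrite /L real_normK ?num_real.
rewrite lamL in ed.
(* At this point the two estimates of the integral of [|phi z| / z], of orders [L^2 * sqrt de] below
   and [1 / sqrt de] above, balance. *)
set de := L ^- 2 in ed.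
have de0 : 0 < de by rewrite invr_gt0 exprn_gt0.
have de1 : de <= 1 by rewrite invf_le1 ?exprn_gt0// exprn_ege1//; lra.
have sde : Num.sqrt de = L^-1.
  by rewrite /de -exprVn sqrtr_sqr ger0_norm// invr_ge0 ltW.
have e1 : eta <= 1 by exact: le_trans de1.
have iN := integrable_norm i.
rewrite (Rintegral_oc_split (ltW e0) e1)// (Rintegral_oc_split ed de1); last first.
  exact: integrable_oc_sub (ltW e0) (lexx _) iN.
have [i2 E2] := @Rintegral_inv_sqrt R (3 / 32 * x) (x / 8 * (L ^+ 2 * (5 / 12))) eta de e0 ed.
have [i3 E3] := @Rintegral_laurent R 0 (3 / 32 * x) (x / 8 * (2 * L)^-1) de 1 de0 de1.
have H1 := @Rintegral_le_mass (fun z => K2 x z * phi z) (cst (L / 8)) 0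
  0 eta (lexx _) e1 i (integrable_oc_cst _ _ _).
have H2 := @Rintegral_le_mass (fun z => K2 x z * phi z) _ (3 / 32 * x)
  eta de (ltW e0) de1 i i2.
(* Here [|phi z| / z] is bounded by [L / 2 * phi z ^+ 2 + 1 / (2 * L * z ^+ 2)]. *)
have H3 := @Rintegral_le_mass (fun z => K2 x z * phi z) _ (3 / 32 * x + x / 16 * L)
  de 1 (ltW de0) (lexx _) i i3.
rewrite E2 in H2; rewrite E3 in H3; rewrite Rintegral_oc_cst ?(ltW e0)// in H1.
have Kphi z : 0 < z -> z <= 1 ->
    `|K2 x z * phi z| <= 3 / 32 * x * phi z ^+ 2 + 3 / 32 * x + x / 8 * (`|phi z| / z).
  move=> z0 z1; rewrite normrM.
  have h := ler_wpM2r (normr_ge0 (phi z)) (K2_le x0 z0 z1).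
  apply: (le_trans h); rewrite -[phi z ^+ 2]real_normK ?num_real//.
  rewrite -subr_ge0.
  have -> : 3 / 32 * x * `|phi z| ^+ 2 + 3 / 32 * x + x / 8 * (`|phi z| / z) -
     (3 / 16 * x + 8^-1 * (x / z)) * `|phi z| = 3 / 32 * x * (`|phi z| - 1) ^+ 2.
    by field; rewrite gt_eqF.
  by rewrite mulr_ge0 ?sqr_ge0// mulr_ge0// ltW.
apply: (le_trans (lerD (H1 _) (lerD (H2 _) (H3 _)))).
- move=> z z0 ze; rewrite mul0r add0r /= normrM.
  have z1 : z <= 1 by exact: le_trans e1.
  have h := ler_pM (normr_ge0 _) (normr_ge0 _) (K2_norm x z) (eigenfun_norm (ltW z0) z1).
  by apply: (le_trans h); rewrite -/L; lra.
- move=> z ez zd; have z0 : 0 < z by exact: lt_trans ez.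
  have z1 : z <= 1 by exact: le_trans de1.
  apply: (le_trans (Kphi z z0 z1)).
  rewrite -addrA lerD2l lerD2l -!mulrA !ler_pM2l ?invr_gt0//.
  have s0 : 0 < Num.sqrt z by rewrite sqrtr_gt0.
  have zs : z = Num.sqrt z ^+ 2 by rewrite sqr_sqrtr// ltW.
  rewrite ler_pdivrMr// [X in _ <= _ * X]zs.
  have := eigenfun_sqrt z0 z1; rewrite lamL => /le_trans; apply.
  by rewrite le_eqVlt; apply/orP; left; apply/eqP; field; rewrite gt_eqF.
- move=> z dz z1; have z0 : 0 < z by exact: lt_trans dz.
  apply: (le_trans (Kphi z z0 z1)).
  rewrite -[phi z ^+ 2]real_normK ?num_real// -subr_ge0.
  have -> : (3 / 32 * x + x / 16 * L) * `|phi z| ^+ 2 +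
      (0 * z + 3 / 32 * x + x / 8 * (2 * L)^-1 * z ^- 2) -
      (3 / 32 * x * `|phi z| ^+ 2 + 3 / 32 * x + x / 8 * (`|phi z| / z)) =
      x / (16 * L) * (L * `|phi z| - z^-1) ^+ 2.
    by field; rewrite !gt_eqF.
  by rewrite mulr_ge0 ?sqr_ge0// divr_ge0 ?mulr_ge0// ltW.
have m1 : mass 0 1 = mass 0 eta + (mass eta de + mass de 1).
  rewrite (mass_split (lexx 0) (ltW e0) e1 (lexx 1)); congr (_ + _).
  exact: mass_split (ltW e0) ed de1 (lexx 1).
rewrite mass01 in m1.
have p1 := mass_ge0 0 eta; have p2 := mass_ge0 eta de; have p3 := mass_ge0 de 1.
set A := mass 0 eta in m1 p1 *; set B := mass eta de in m1 p2 *; set C := mass de 1 in m1 p3 *.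
have se0 : 0 <= Num.sqrt eta := sqrtr_ge0 eta.
have xL : 0 <= x * L by rewrite mulr_ge0// ltW.
have xLC : (x * L) * C <= x * L by rewrite ger_pMr ?mulr_gt0//; lra.
have xBC : x * (B + C) <= x by rewrite ger_pMr//; lra.
have xLs : 0 <= x * L ^+ 2 * Num.sqrt eta.
  by rewrite mulr_ge0// mulr_ge0 ?sqr_ge0// ltW.
have xe : 0 <= x * eta by rewrite mulr_ge0// ltW.
have xiL : 0 <= x * L^-1 by rewrite divr_ge0// ltW.
have -> : 0 * A + L / 8 * (eta - 0) +
  (3 / 32 * x * B + (3 / 32 * x * (de - eta) +
     2 * (x / 8 * (L ^+ 2 * (5 / 12))) * (Num.sqrt de - Num.sqrt eta)) +
   ((3 / 32 * x + x / 16 * L) * C +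
     (0 * 1 ^+ 2 / 2 + 3 / 32 * x * 1 - x / 8 * (2 * L)^-1 * 1^-1 -
      (0 * de ^+ 2 / 2 + 3 / 32 * x * de - x / 8 * (2 * L)^-1 * de^-1)))) =
  L / 8 * eta + 3 / 32 * (x * (B + C)) + x * L * C / 16 + 3 / 32 * x - 3 / 32 * (x * eta) +
  5 / 48 * (x * L) - 5 / 48 * (x * L ^+ 2 * Num.sqrt eta) - (x * L^-1) / 16 + x * L / 16.
  by rewrite sde /de; field; rewrite gt_eqF.
have -> : x * (3 / 16 + 11 / 48 * L) = 3 / 16 * x + 11 / 48 * (x * L) by ring.
lra.
Qed.

Lemma eigenfun_linear x : 0 < x -> x <= 1 ->
  `|phi x| <= x * (3^-1 * `|lam| ^+ 3).
Proof.
move=> x0 x1.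
set L := `|lam|; have L2 : 2 <= L := eigenvalue_ge2.
have L0 : 0 < L by lra.
have lamL : lam ^+ 2 = L ^+ 2 by rewrite /L real_normK ?num_real.
have main : `|phi x| <= L ^+ 2 * (x * (3 / 16 + 11 / 48 * L)).
  apply/ler_addgt0Pr => e e0.
  (* The second entry makes the term [L ^+ 2 * (L / 8 * eta)] at most [e]. *)
  pose eta := Num.min (L ^- 2) (8 * e / L ^+ 3).
  have eta0 : 0 < eta by rewrite lt_min invr_gt0 exprn_gt0// divr_gt0 ?mulr_gt0 ?exprn_gt0.
  have ed : eta <= lam ^- 2 by rewrite lamL ge_min lexx.
  have ee : eta <= 8 * e / L ^+ 3 by rewrite ge_min lexx orbT.
  apply: (le_trans (eigenfun_trunc x0 x1 eta0 ed)); rewrite lamL -/L mulrDr addrC lerD2l.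
  apply: (@le_trans _ _ (L ^+ 2 * (L / 8 * (8 * e / L ^+ 3)))).
    by rewrite ler_pM2l ?exprn_gt0// ler_pM2l ?divr_gt0.
  by rewrite le_eqVlt; apply/orP; left; apply/eqP; field; rewrite gt_eqF.
apply: (le_trans main); rewrite mulrCA ler_pM2l//.
have -> : 3^-1 * L ^+ 3 = L ^+ 2 * (3^-1 * L) by ring.
(* Since [L >= 2], the constant 3/16 is at most [3/32 * L], and [3/32 + 11/48 = 31/96 < 1/3]. *)
by rewrite ler_pM2l ?exprn_gt0//; lra.
Qed.

End Eigenfunction.

Theorem theorem3p2 (R : realType) (phi : nat -> R -> R) (lam : nat -> R) :
  max_orthonormal_eigensystem phi lam ->
  forall (j : nat) (x : R), 0 < x -> x <= 1 ->
    `|phi j x| / x <= C0 R * `|lam j| ^+ 3.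
Proof.
move=> [eig [orth _]] j x x0 x1; have [ej lj] := eig j.
have nj : ip (phi j) (phi j) = 1 by rewrite orth eqxx.
rewrite ler_pdivrMr// mulrC; apply: (le_trans (eigenfun_linear ej nj lj x0 x1)).
rewrite ler_pM2l// ler_wpM2r ?exprn_ge0// /C0 lerDl invr_ge0.
by rewrite mulr_ge0 ?expR_ge0// mulr_ge0// sqrtr_ge0.
Qed.
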